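(* For every non-crossing partition $\sigma$ of $\{\bar1,\dots,\bar n\}$, the concordance vector $w_\sigma$ lies in $\bigwedge^{n-1}V$, and when it is expanded in the basis $\{v_{i_1}\wedge\cdots\wedge v_{i_{n-1}}: 1\le i_1<\dots<i_{n-1}\le 2n-2\}$ of $\bigwedge^{n-1}V$, every coefficient is equal to $0$ or to $1$.
   Context: Place $\bar 1,\dots,\bar n$ clockwise on a circle and $\tilde i$ on the arc between $\bar i$ and $\overline{i+1}$ ($\tilde n$ between $\bar n$ and $\bar 1$). For a non-crossing partition $\sigma$ of $\{\bar1,\dots,\bar n\}$ its dual $\tilde\sigma$ is the coarsest partition of $\{\tilde 1,\dots,\tilde n\}$ with $\sigma\cup\tilde\sigma$ non-crossing. Identify $\bar i\leftrightarrow 2i-1$, $\tilde i\leftrightarrow 2i$. An $(n-1)$-subset $I\subset[2n]$ is concordant with $\sigma$ if each block of $\sigma$ and of $\tilde\sigma$ contains exactly one element of $[2n]\setminus I$. $w_\sigma=\sum_{I\text{ concordant}}e_I\in\bigwedge^{n-1}\mathbb R^{2n}$, where $e_I=e_{i_1}\wedge\dots\wedge e_{i_{n-1}}$ ($i_1<\dots<i_{n-1}$) for the standard basis $e_k$. $V=\{v\in\mathbb R^{2n}:\sum_i(-1)^iv_{2i}=0,\sum_i(-1)^iv_{2i-1}=0\}$ with basis $v_k=e_k+e_{k+2}$, $k=1,\dots,2n-2$. *)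

(* Defs.v *)
From HB Require Import structures.
From mathcomp Require Import all_boot all_order all_algebra.
From mathcomp Require Import reals.
From mathcomp Require Import zify.

Set Implicit Arguments.
Unset Strict Implicit.
Unset Printing Implicit Defensive.

Import Order.TTheory GRing.Theory Num.Theory.
Local Open Scope ring_scope.

(* All indices are 0-based: the element k of [2n] is the ordinal of value     *)
(* k - 1, so the barred points are the even ordinals and the tilde points the *)
(* odd ones, and the order of 'I_(n.*2) is the clockwise order on the circle. *)

Section NonCrossing.
Local Open Scope nat_scope.

Definition crossing m (B C : {set 'I_m}) : bool :=
  [exists a in B, exists b in C, exists c in B, exists d in C,
     [&& a < b, b < c & c < d]].

Definition noncrossing m (P : {set {set 'I_m}}) : bool :=
  [forall B in P, forall C in P, (B != C) ==> ~~ crossing B C].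

Fact bar_subproof n (i : 'I_n) : i.*2 < n.*2.
Proof. by rewrite ltn_double. Qed.

Fact tilde_subproof n (i : 'I_n) : i.*2.+1 < n.*2.
Proof. by rewrite ltn_Sdouble. Qed.

Definition bar n (i : 'I_n) : 'I_(n.*2) := Ordinal (bar_subproof i).
Definition tilde n (i : 'I_n) : 'I_(n.*2) := Ordinal (tilde_subproof i).

Definition on_circle n (sigma tau : {set {set 'I_n}}) : {set {set 'I_(n.*2)}} :=
  [set @bar n @: B | B : {set 'I_n} in sigma]
    :|: [set @tilde n @: B | B : {set 'I_n} in tau].

Definition refines (T : finType) (P Q : {set {set T}}) : bool :=
  [forall B in P, exists C in Q, B \subset C].

Definition is_dual n (sigma tau : {set {set 'I_n}}) : bool :=
  [&& partition tau [set: 'I_n], noncrossing (on_circle sigma tau)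
    & [forall tau' : {set {set 'I_n}},
         partition tau' [set: 'I_n] && noncrossing (on_circle sigma tau')
         ==> refines tau' tau]].

(* The default value is never used for a non-crossing partition: see dualP.   *)
Definition dual n (sigma : {set {set 'I_n}}) : {set {set 'I_n}} :=
  odflt set0 [pick tau | is_dual sigma tau].

Lemma crossingP m (B C : {set 'I_m}) :
  reflect (exists a b c d, [/\ a \in B, b \in C, c \in B, d \in C
                             & [&& a < b, b < c & c < d]])
          (crossing B C).
Proof.
apply: (iffP exists_inP) => [[a aB /exists_inP[b bC /exists_inP[c cB]]]|].
  by case/exists_inP=> d dC abcd; exists a, b, c, d.
case=> a [b [c [d [aB bC cB dC abcd]]]]; exists a => //.
apply/exists_inP; exists b => //; apply/exists_inP; exists c => //.
by apply/exists_inP; exists d.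
Qed.

Lemma noncrossingP m (P : {set {set 'I_m}}) :
  reflect (forall B C a b c d, B \in P -> C \in P ->
             a \in B -> b \in C -> c \in B -> d \in C ->
             a < b -> b < c -> c < d -> B = C)
          (noncrossing P).
Proof.
apply: (iffP forall_inP) => [nc B C a b c d BP CP aB bC cB dC ab bc cd|nc B BP].
  apply/eqP; apply: contraT => neqBC.
  move/forall_inP/(_ C CP)/implyP/(_ neqBC)/crossingP: (nc B BP); case.
  by exists a, b, c, d; rewrite ab bc cd.
apply/forall_inP => C CP; apply/implyP => /eqP neqBC; apply/crossingP.
case=> a [b [c [d [aB bC cB dC /and3P[ab bc cd]]]]].
exact/neqBC/(nc B C a b c d).
Qed.

Lemma refines_anti n (P Q : {set {set 'I_n}}) :
  partition P [set: 'I_n] -> partition Q [set: 'I_n] ->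
  refines P Q -> refines Q P -> P = Q.
Proof.
suff sub (P1 Q1 : {set {set 'I_n}}) :
    partition P1 [set: 'I_n] -> refines P1 Q1 -> refines Q1 P1 ->
    P1 \subset Q1.
  by move=> pP pQ PQ QP; apply/eqP; rewrite eqEsubset !sub.
case/and3P=> _ tP nP PQ QP; apply/subsetP => B BP.
have /exists_inP[C CQ sBC] := forall_inP PQ B BP.
have /exists_inP[D DP sCD] := forall_inP QP C CQ.
have [x xB] : exists x, x \in B.
  by apply/set0Pn; apply: contraNneq nP => <-.
have xD : x \in D by apply: (subsetP sCD); apply: (subsetP sBC).
have eBD : B = D by rewrite -(def_pblock tP BP xB) (def_pblock tP DP xD).
by have -> : B = C by apply/eqP; rewrite eqEsubset sBC /= {1}eBD.
Qed.

Lemma is_dual_uniq n (sigma tau tau' : {set {set 'I_n}}) :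
  is_dual sigma tau -> is_dual sigma tau' -> tau = tau'.
Proof.
case/and3P=> p1 n1 /forallP m1 /and3P[p2 n2 /forallP m2].
apply: refines_anti => //.
  by apply: (implyP (m2 tau)); rewrite p1.
by apply: (implyP (m1 tau')); rewrite p2.
Qed.

Lemma is_dual_exists n (sigma : {set {set 'I_n}}) :
  noncrossing sigma -> exists tau, is_dual sigma tau.
Proof.
move=> ncs.
pose f (i : 'I_n) := [set p : 'I_n * 'I_n |
  [exists B in sigma, (p.1 \in B) && (p.2 \in B)] && (p.1 <= i < p.2)].
pose tau := preim_partition f [set: 'I_n].
have ptau : partition tau [set: 'I_n] by exact: preim_partitionP.
have tauE D i j : D \in tau -> i \in D -> (j \in D) = (f i == f j).
  move=> Dt iD; have /and3P[_ tt _] := ptau.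
  rewrite -(def_pblock tt Dt iD) pblock_equivalence_partition ?inE //.
  by split=> // /eqP->.
have fP B x y i : B \in sigma -> x \in B -> y \in B ->
    ((x, y) \in f i) = (x <= i < y).
  move=> Bs xB yB; rewrite inE /=.
  by have -> : [exists B in sigma, (x \in B) && (y \in B)]
    by apply/exists_inP; exists B; rewrite ?xB.
exists tau; rewrite /is_dual ptau /=; apply/andP; split.
  apply/noncrossingP => B C a b c d.
  case/setUP=> /imsetP[B' B't ->]; case/setUP=> /imsetP[C' C't ->];
  case/imsetP=> a' a'B ->; case/imsetP=> b' b'C ->;
  case/imsetP=> c' c'B ->; case/imsetP=> d' d'C -> /= ab bc cd.
  - have -> // : B' = C'.
    by move/noncrossingP: ncs => /(_ B' C' a' b' c' d'); apply => //; lia.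
  - have /eqP E : f b' == f d' by rewrite -(tauE _ _ _ C't).
    have := fP B' a' c' b' B't a'B c'B; rewrite E (fP B') //; lia.
  - have /eqP E : f a' == f c' by rewrite -(tauE _ _ _ B't).
    have := fP C' b' d' a' C't b'C d'C; rewrite E (fP C') //; lia.
  - have /eqP E : f a' == f c' by rewrite -(tauE _ _ _ B't).
    have /eqP E' : f b' == f d' by rewrite -(tauE _ _ _ C't).
    have ab' : f a' = f b'.
      apply/setP => -[x y]; move/setP/(_ (x, y)): E; move/setP/(_ (x, y)): E'.
      rewrite !inE /=.
      case: [exists _ in _, _] => //=; lia.
    have b'B : b' \in B' by rewrite (tauE _ a') // ab'.
    have /and3P[_ tt _] := ptau.
    by rewrite -(def_pblock tt B't b'B) (def_pblock tt C't b'C).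
apply/forallP => tau'; apply/implyP => /andP[ptau' /noncrossingP nc].
have /and3P[_ _ ntau'] := ptau'.
have bt (B D : {set 'I_n}) x : x \in B -> @bar n @: B <> @tilde n @: D.
  move=> xB /setP/(_ (bar x)); rewrite imset_f // => /esym/imsetP[y _].
  by move/(congr1 val) => /=; lia.
have sub D i j : D \in tau' -> i \in D -> j \in D -> f i \subset f j.
  move=> Dt iD jD; apply/subsetP => -[x y].
  rewrite !inE /= => /andP[/[dup] ex -> /=].
  case/exists_inP: ex => B Bs /andP[xB yB] /andP[xi iy].
  have Bc : @bar n @: B \in on_circle sigma tau'.
    by apply/setUP; left; apply/imsetP; exists B.
  have Dc : @tilde n @: D \in on_circle sigma tau'.
    by apply/setUP; right; apply/imsetP; exists D.
  apply/andP; split; rewrite leqNgt; apply/negP => h.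
    apply: (bt B D x xB); apply/esym.
    apply: (nc _ _ (tilde j) (bar x) (tilde i) (bar y));
      rewrite ?imset_f //=; move: h xi iy; clear; lia.
  apply: (bt B D x xB).
  apply: (nc _ _ (bar x) (tilde i) (bar y) (tilde j));
    rewrite ?imset_f //=; move: h xi iy; clear; lia.
apply/forall_inP => D Dt.
have [i iD] : exists i, i \in D.
  by apply/set0Pn; apply: contraNneq ntau' => <-.
have /and3P[/eqP ct _ _] := ptau.
have ic : i \in cover tau by rewrite ct inE.
apply/exists_inP; exists (pblock tau i); first exact: pblock_mem.
apply/subsetP => j jD; rewrite (tauE _ i) ?mem_pblock ?pblock_mem //.
by rewrite eqEsubset !(sub D).
Qed.

Lemma dualP n (sigma : {set {set 'I_n}}) :
  noncrossing sigma -> is_dual sigma (dual sigma).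
Proof.
move=> ncs; rewrite /dual; case: pickP => [//|no].
by have [tau] := is_dual_exists ncs; rewrite no.
Qed.

Definition concordant n (sigma : {set {set 'I_n}}) (I : {set 'I_(n.*2)}) : bool :=
  [&& #|I| == n.-1,
      [forall B in sigma, #|(@bar n @: B) :\: I| == 1]
    & [forall B in dual sigma, #|(@tilde n @: B) :\: I| == 1]].

End NonCrossing.

(* The exterior algebra of R^m, an element being the family of its coordinates *)
(* on the basis (e_K), K a subset of 'I_m.                                    *)
Definition ext (R : realType) (m : nat) := {ffun {set 'I_m} -> R^o}.

Section Exterior.
Variables (R : realType) (m : nat).
Implicit Types (u w : ext R m) (v : 'rV[R]_m).

Definition ext1 : ext R m := [ffun K : {set 'I_m} => (K == set0)%:R].

Definition ext_vec v : ext R m := [ffun K : {set 'I_m} => \sum_i v 0 i * (K == [set i])%:R].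

Definition inversions (I J : {set 'I_m}) : nat :=
  #|[set p : 'I_m * 'I_m | [&& p.1 \in I, p.2 \in J & (p.2 < p.1)%N]]|.

(* e_I /\ e_J = (-1) ^ inversions I J * e_(I u J) for disjoint I and J, and 0 *)
(* otherwise, extended bilinearly.                                            *)
Definition wedge u w : ext R m :=
  [ffun K : {set 'I_m} => \sum_(I : {set 'I_m} | I \subset K)
               (-1) ^+ inversions I (K :\: I) * (u I * w (K :\: I))].

Definition wedges (s : seq 'rV[R]_m) : ext R m :=
  foldr (fun v w => wedge (ext_vec v) w) ext1 s.

Definition in_ext_power (k : nat) (U : {pred 'rV[R]_m}) (w : ext R m) : Prop :=
  exists (N : nat) (c : 'I_N -> R) (t : 'I_N -> k.-tuple 'rV[R]_m),
    (forall i, {subset t i <= U}) /\ w = \sum_(i < N) c i *: wedges (t i).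

(* The standard basis vector, as a function of a natural number index.        *)
Definition stdb (k : nat) : 'rV[R]_m := \row_(j < m) (j == k :> nat)%:R.

End Exterior.

Arguments stdb {R m} k.

(* enum lists the elements of a set of ordinals in increasing order.          *)
Definition e_wedge (R : realType) (m : nat) (I : {set 'I_m}) : ext R m :=
  wedges [seq stdb (val i) | i <- enum I].

Definition concordance_vector (R : realType) (n : nat) (sigma : {set {set 'I_n}}) :
    ext R n.*2 :=
  \sum_(I : {set 'I_(n.*2)} | concordant sigma I) e_wedge R I.

(* The sign of the i-th term is (-1) ^ i for the 1-based index i.             *)
Definition Vspace (R : realType) (n : nat) : {pred 'rV[R]_(n.*2)} :=
  [pred v : 'rV[R]_(n.*2) |
     (\sum_(i < n) (-1) ^+ i.+1 * v 0 (tilde i) == 0)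
       && (\sum_(i < n) (-1) ^+ i.+1 * v 0 (bar i) == 0)].

Arguments Vspace : clear implicits.

Definition v_basis (R : realType) (n : nat) (k : 'I_(n.*2 - 2)) : 'rV[R]_(n.*2) :=
  stdb k + stdb k.+2.

Definition v_wedge (R : realType) (n : nat) (J : {set 'I_(n.*2 - 2)}) : ext R n.*2 :=
  wedges [seq v_basis R k | k <- enum J].

Definition is_expansion (R : realType) (n : nat) (w : ext R n.*2)
    (c : {set 'I_(n.*2 - 2)} -> R) : Prop :=
  w = \sum_(J : {set 'I_(n.*2 - 2)} | #|J| == n.-1) c J *: v_wedge R J.

(* Main.v *)
Require Import Defs.
From HB Require Import structures.
From mathcomp Require Import all_boot all_order all_algebra.
From mathcomp Require Import reals zify.

(* Write the blocks of sigma and of its dual around the circle as a word of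
   length 2n. For n > 1 some point i, neither the first nor the last one, is
   a singleton whose two neighbours i - 1 and i + 1 lie in a common block;
   removing i and merging these neighbours gives the word of a non-crossing
   partition sigma' of n - 1 points. If e' is the sequence of vectors
     e'_k = e_k for k <= i - 1, and e'_k = - e_(k + 2) for k > i - 1,
   then w_sigma(e) = (-1) ^ n v_(i - 1) /\ w_sigma'(e'), because each
   concordant set of sigma' gives, up to this common sign, exactly the
   concordant sets of sigma above it. Modulo v_(i - 1), the vectors
   v'_k = e'_k + e'_(k + 2) are v_k for k < i - 2, v_(i - 2) - v_i for
   k = i - 2, and - v_(k + 2) for k > i - 2, so multiplication by v_(i - 1)
   also turns each v'_J, up to the same sign, into one or two v_K, every K
   coming from a single J. Since e is arbitrary here, induction shows that
   w_sigma is a sum of distinct v_J. The v_J are free because v_J is e_J plus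
   terms e_K with a larger sum of indices. *)

Set Implicit Arguments.
Unset Strict Implicit.
Unset Printing Implicit Defensive.

Import Order.TTheory GRing.Theory Num.Theory.
Local Open Scope ring_scope.

(** * Left multiplication by a vector in the exterior algebra *)

Section ExteriorProduct.
Variables (R : realType) (m : nat).
Implicit Types (u v : 'rV[R]_m) (w : ext R m) (K : {set 'I_m}).

(** The exponent of the sign in e_i /\ e_(K \ i) = (-1) ^ rank e_K. *)
Definition rank_in K (i : 'I_m) : nat := #|[set k in K | (k < i)%N]|.

Definition lmul v w : ext R m := wedge (ext_vec v) w.

(** [ext_vec v] is supported on singletons, and the inversions between {i} and K \ i are the
    elements of K below i. *)
Lemma lmulE v w K :
  lmul v w K = \sum_(i in K) (-1) ^+ rank_in K i * (v 0 i * w (K :\ i)).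
Proof.
rewrite ffunE (bigID (fun I : {set 'I_m} => #|I| == 1%N)) /= [X in _ + X]big1 => [|I].
  rewrite addr0 (eq_bigl (fun I => I \in [set [set i] | i in K])).
    rewrite big_imset => [|i j _ _ /set1_inj//].
    apply: eq_bigr => i iK; congr (_ ^+ _ * (_ * _)).
      rewrite /inversions /rank_in.
      rewrite -(card_imset (mem [set k in K | (k < i)%N])
                           (f := fun k => (i, k))) => [|? ? []//].
      apply: eq_card => -[a b]; rewrite !inE; apply/idP/imsetP.
        case/and3P=> /= /eqP-> /andP[_ bK] bi.
        by exists b; rewrite ?inE ?bK.
      case=> k; rewrite !inE => /andP[kK ki] [-> ->] /=.
      by rewrite eqxx kK ki !andbT neq_ltn ki.
    rewrite ffunE (bigD1 i) //= eqxx mulr1 big1 ?addr0 // => j ji.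
    by case: eqP => [/set1_inj/esym/eqP|]; rewrite ?(negPf ji) ?mulr0.
  move=> I; apply/andP/imsetP => [[sIK /cards1P[i eI]]|[i iK ->]].
    by exists i => //; rewrite -sub1set -eI.
  by rewrite sub1set cards1.
case/andP=> _ nI; rewrite ffunE big1 ?mul0r ?mulr0 // => i _.
by case: (I =P [set i]) nI => [->|_ _]; rewrite ?cards1 ?mulr0.
Qed.

Lemma lmulDl u v w : lmul (u + v) w = lmul u w + lmul v w.
Proof.
apply/ffunP => K; rewrite [RHS]ffunE !lmulE -big_split; apply: eq_bigr => i _.
by rewrite mxE mulrDl mulrDr.
Qed.

Lemma lmulZl (a : R) v w : lmul (a *: v) w = a *: lmul v w.
Proof.
apply/ffunP => K; rewrite [RHS]ffunE !lmulE scaler_sumr; apply: eq_bigr => i _.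
by rewrite mxE /GRing.scale /= -!mulrA mulrCA.
Qed.

Lemma lmulDr v w w' : lmul v (w + w') = lmul v w + lmul v w'.
Proof.
apply/ffunP => K; rewrite [RHS]ffunE !lmulE -big_split; apply: eq_bigr => i _.
by rewrite ffunE !mulrDr.
Qed.

Lemma lmulZr (a : R) v w : lmul v (a *: w) = a *: lmul v w.
Proof.
apply/ffunP => K; rewrite [RHS]ffunE !lmulE scaler_sumr; apply: eq_bigr => i _.
by rewrite ffunE /GRing.scale /= (mulrCA (v 0 i) a) (mulrCA _ a).
Qed.

Lemma lmulNl v w : lmul (- v) w = - lmul v w.
Proof. by rewrite -scaleN1r lmulZl scaleN1r. Qed.

Lemma lmulNr v w : lmul v (- w) = - lmul v w.
Proof. by rewrite -scaleN1r lmulZr scaleN1r. Qed.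

Lemma lmul0r v : lmul v 0 = 0.
Proof. by rewrite -(scale0r 0) lmulZr !scale0r. Qed.

Lemma lmul_sumr (T : Type) v (s : seq T) (F : T -> ext R m) :
  lmul v (\sum_(i <- s) F i) = \sum_(i <- s) lmul v (F i).
Proof. exact: (big_morph (lmul v) (lmulDr v) (lmul0r v)). Qed.

Lemma rank_inD1 K i j : i \in K ->
  rank_in K j = ((i < j) + rank_in (K :\ i) j)%N.
Proof.
move=> iK; rewrite /rank_in (cardsD1 i) inE iK /=; congr (_ + _)%N.
by apply: eq_card => k; rewrite !inE andbA.
Qed.

(** Both sides are sums over ordered pairs of distinct i, j in K; exchanging the two removals
    changes the total rank by one, as exactly one of i < j and j < i holds. *)
Lemma lmulC u v w : lmul u (lmul v w) = - lmul v (lmul u w).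
Proof.
have E x y K : lmul x (lmul y w) K = \sum_(i in K) \sum_(j in K | j != i)
    (-1) ^+ (rank_in K i + rank_in (K :\ i) j) *
    (x 0 i * y 0 j * w (K :\ i :\ j)).
  rewrite lmulE; apply: eq_bigr => i iK; rewrite lmulE !mulr_sumr.
  apply: eq_big => [j|j _]; first by rewrite !inE andbC.
  by rewrite [x _ _ * _]mulrCA !mulrA exprD.
apply/ffunP => K; rewrite [RHS]ffunE !E -sumrN.
under [RHS]eq_bigr do rewrite -sumrN.
rewrite (exchange_big_dep (fun j => j \in K)) /= => [|i j _ /andP[]//].
apply: eq_bigr => j jK.
apply: eq_big => [i|i /andP[iK]]; first by rewrite jK eq_sym.
rewrite jK /= eq_sym => ij.
have -> : K :\ i :\ j = K :\ j :\ i.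
  by apply/setP => k; rewrite !inE andbCA.
rewrite -mulNr [v _ _ * _]mulrC; congr (_ * _).
rewrite (rank_inD1 j iK) (rank_inD1 i jK) !exprD.
case: (ltngtP i j) => [h|h|/val_inj h]; last by rewrite h eqxx in ij.
  by rewrite expr0 expr1 mulN1r mul1r mulNr opprK mulrC.
by rewrite expr0 expr1 mulN1r mul1r !mulNr mulrC.
Qed.

Lemma lmul_self v w : lmul v (lmul v w) = 0.
Proof.
apply/ffunP => K; rewrite [RHS]ffunE; apply/eqP; rewrite -eqNr.
by rewrite {2}lmulC [eqbRHS]ffunE.
Qed.

Lemma wedges_cons v s : wedges (v :: s) = lmul v (wedges s).
Proof. by []. Qed.

Lemma lmul_wedges_cat v s t :
  lmul v (wedges (s ++ t)) = (-1) ^+ size s *: wedges (s ++ v :: t).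
Proof.
elim: s => [|x s IH]; first by rewrite scale1r.
by rewrite ?cat_cons ?cat0s ?map_cons !wedges_cons lmulC IH lmulZr exprS mulN1r scaleNr.
Qed.

Lemma wedges_catN (s t : seq ('rV[R]_m)) :
  wedges (s ++ [seq - x | x <- t]) = (-1) ^+ size t *: wedges (s ++ t).
Proof.
elim: s => [|x s IH]; last by rewrite !cat_cons !wedges_cons IH lmulZr.
rewrite !cat0s; elim: t => [|x t IH]; first by rewrite scale1r.
by rewrite map_cons !wedges_cons IH lmulZr lmulNl scalerN exprS mulN1r scaleNr.
Qed.

(** Anticommutation brings [v] next to each factor in turn, where the multiple of [v] vanishes. *)
Lemma lmul_wedges_mod (T : eqType) v (f g : T -> 'rV[R]_m) (s : seq T) :
  {in s, forall k, exists a, f k = g k + a *: v} ->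
  lmul v (wedges (map f s)) = lmul v (wedges (map g s)).
Proof.
elim: s => [//|k s IH] h; rewrite ?cat_cons ?cat0s ?map_cons !wedges_cons.
have [a ->] := h k (mem_head _ _).
rewrite lmulDl lmulDr lmulZl lmulZr lmul_self scaler0 addr0.
rewrite lmulC IH ?[RHS]lmulC // => j js.
by apply: h; rewrite inE js orbT.
Qed.

Lemma wedges_swap s u v t :
  wedges (s ++ u :: v :: t) = - wedges (s ++ v :: u :: t).
Proof.
elim: s => [|x s IH]; first by rewrite ?cat_cons ?cat0s ?map_cons !wedges_cons lmulC.
by rewrite ?cat_cons ?cat0s ?map_cons !wedges_cons IH lmulNr.
Qed.

Lemma wedges_catD s u v t :
  wedges (s ++ (u + v) :: t) = wedges (s ++ u :: t) + wedges (s ++ v :: t).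
Proof.
elim: s => [|x s IH]; first by rewrite ?cat_cons ?cat0s ?map_cons !wedges_cons lmulDl.
by rewrite ?cat_cons ?cat0s ?map_cons !wedges_cons IH lmulDr.
Qed.

Lemma wedges_catNl s u t : wedges (s ++ - u :: t) = - wedges (s ++ u :: t).
Proof.
elim: s => [|x s IH]; first by rewrite ?cat_cons ?cat0s ?map_cons !wedges_cons lmulNl.
by rewrite ?cat_cons ?cat0s ?map_cons !wedges_cons IH lmulNr.
Qed.

Lemma wedges_dup s u t : wedges (s ++ u :: u :: t) = 0.
Proof.
elim: s => [|x s IH]; first by rewrite ?cat_cons ?cat0s ?map_cons !wedges_cons lmul_self.
by rewrite ?cat_cons ?cat0s ?map_cons !wedges_cons IH lmul0r.
Qed.

End ExteriorProduct.

(** * Wedges selected by bit masks, and the merging of two neighbours *)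

Section MaskedWedges.
Variables (R : realType) (m : nat).
Implicit Types (e : nat -> 'rV[R]_m) (a b c : bitseq) (p : nat).

(** Subsets are bit sequences, so that inserting positions is concatenation; [e] is arbitrary, so
    that the induction can pass to [collapse p e]. *)
Definition masked_wedges e b : ext R m :=
  wedges [seq e k | k <- mask b (iota 0 (size b))].

(* Masks over the v_k are padded with a false bit at both ends, so position k
   stands for v_(k - 1); the value at position 0 is never selected. *)
Definition vpair e k : 'rV[R]_m := e k.-1 + e k.+1.

(** The sequence e' of the induction, with p = i - 1; the entries p + 1 and p + 2 of [e] drop
    out. *)
Definition collapse p e k : 'rV[R]_m := if (k <= p)%N then e k else - e k.+2.

(** Bit p becomes three bits: the terms of (e_p + e_(p+2)) /\ e_p if it is true, of e_p + e_(p+2)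
    alone if it is false. *)
Definition split_e p b : seq bitseq :=
  let a := take p b in let c := drop p.+1 b in
  if nth false b p then [:: a ++ [:: true, false, true & c]]
  else [:: a ++ [:: true, false, false & c]; a ++ [:: false, false, true & c]].

(** The middle bit selects the new factor e_p + e_(p+2), which is [vpair e p.+1]; a true bit p
    splits because v'_p is [vpair e p - vpair e p.+2]. *)
Definition split_v p b : seq bitseq :=
  let a := take p b in let c := drop p.+1 b in
  if nth false b p then [:: a ++ [:: true, true, false & c]; a ++ [:: false, true, true & c]]
  else [:: a ++ [:: false, true, false & c]].

Lemma split_nth p b : (p < size b)%N ->
  b = take p b ++ nth false b p :: drop p.+1 b.
Proof. by move=> pb; rewrite -drop_nth // cat_take_drop. Qed.

Lemma mask_iota3 a b c : mask (a ++ b ++ c) (iota 0 (size (a ++ b ++ c))) =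
  mask a (iota 0 (size a)) ++ mask b (iota (size a) (size b))
    ++ mask c (iota (size b + size a) (size c)).
Proof. by rewrite !size_cat !iotaD add0n addnC !mask_cat ?size_iota. Qed.

Lemma mask_iota_add2 c q : mask c (iota q.+2 (size c)) = map (addn 2) (mask c (iota q (size c))).
Proof. by rewrite map_mask -iotaDl. Qed.

(** Moving the new factor to position p costs one sign per true bit before p, and the minus in
    [collapse] one per true bit after p; a true bit p adds the swap of e_(p+2) and e_p. *)
Lemma lmul_collapse_e e p b : (p < size b)%N ->
  lmul (e p + e p.+2) (masked_wedges (collapse p e) b) =
  (-1) ^+ count id b *: \sum_(b' <- split_e p b) masked_wedges e b'.
Proof.
move=> pb; rewrite /split_e.
have sa : size (take p b) = p by rewrite size_take pb.
rewrite {1 2}(split_nth pb); move: (take p b) (drop p.+1 b) (nth _ b p) sa.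
move=> a c x sa {pb b}; rewrite /masked_wedges.
rewrite -cat1s mask_iota3 /= addnC addn1 !map_cat count_cat /= sa.
have -> : [seq collapse p e k | k <- mask a (iota 0 p)] =
          [seq e k | k <- mask a (iota 0 p)].
  apply/eq_in_map => k /mem_mask; rewrite mem_iota add0n /= => kp.
  by rewrite /collapse ltnW.
have -> : [seq collapse p e k | k <- mask c (iota p.+1 (size c))] =
          [seq - v | v <- [seq e k | k <- mask c (iota p.+3 (size c))]].
  rewrite mask_iota_add2 -!map_comp; apply/eq_in_map => k /mem_mask.
  by rewrite mem_iota /collapse => /andP[kp _] /=; rewrite leqNgt kp.
rewrite catA wedges_catN -catA lmulZr lmul_wedges_cat !size_map !size_mask ?size_iota //.
rewrite scalerA -exprD.
have E x1 x2 x3 : mask (a ++ [:: x1, x2, x3 & c]) (iota 0 (size (a ++ [:: x1, x2, x3 & c]))) =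
  mask a (iota 0 p) ++ mask [:: x1; x2; x3] (iota p 3) ++ mask c (iota p.+3 (size c)).
  by have := mask_iota3 a [:: x1; x2; x3] c; rewrite sa.
case: x => /=; rewrite ?big_cons big_nil !E !map_cat /= ?addr0 /collapse ?leqnn.
  rewrite wedges_catD wedges_dup add0r wedges_swap !scalerN -scaleNr.
  by rewrite add1n addnS exprS mulN1r [(count id c + _)%N]addnC opprK.
by rewrite wedges_catD [(count id c + _)%N]addnC add0n.
Qed.

Lemma lmul_collapse_v e p b : (p < size b)%N ->
  lmul (e p + e p.+2) (masked_wedges (vpair (collapse p e)) b) =
  (-1) ^+ count id b *: \sum_(b' <- split_v p b) masked_wedges (vpair e) b'.
Proof.
move=> pb; rewrite /split_v.
(* [g k] is v'_k modulo e_p + e_(p+2). Only k = p + 1 changes: e_p - e_(p+4) is - (e_(p+2) +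
   e_(p+4)) plus that vector. *)
pose g k := if (k < p)%N then vpair e k
            else if k == p then vpair e p - vpair e p.+2 else - vpair e k.+2.
rewrite {1}/masked_wedges (lmul_wedges_mod (g := g)) => [|k _]; last first.
  rewrite /g /vpair /collapse; case: (ltngtP k p) => [kp|pk|->].
  - exists 0; rewrite scale0r addr0.
    by have -> : (k.-1 <= p)%N by lia.
  - case: k pk => // k pk; rewrite ltnS in pk.
    move: pk; rewrite leq_eqVlt => /orP[/eqP ->|pk] /=.
      by exists 1; rewrite leqnn scale1r opprD (addrC (e k) (e k.+2)) addrACA addNr add0r addrC.
    exists 0; rewrite [(k <= p)%N]leqNgt pk /=.
    by rewrite scale0r addr0 opprD.
  - exists 0; rewrite leq_pred scale0r addr0 /=.
    by rewrite opprD addrA addrK.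
have sa : size (take p b) = p by rewrite size_take pb.
rewrite {1 2 3}(split_nth pb); move: (take p b) (drop p.+1 b) (nth _ b p) sa.
move=> a c x sa {pb b}; rewrite /masked_wedges.
rewrite -cat1s mask_iota3 /= addnC addn1 !map_cat count_cat /= sa.
have -> : [seq g k | k <- mask a (iota 0 p)] =
          [seq vpair e k | k <- mask a (iota 0 p)].
  by apply/eq_in_map => k /mem_mask; rewrite mem_iota add0n /g /= => ->.
have -> : [seq g k | k <- mask c (iota p.+1 (size c))] =
          [seq - v | v <- [seq vpair e k | k <- mask c (iota p.+3 (size c))]].
  rewrite mask_iota_add2 -!map_comp; apply/eq_in_map => k /mem_mask.
  rewrite mem_iota /g => /andP[pk _] /=; rewrite ltnNge ltnW //=.
  by rewrite gtn_eqF.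
rewrite catA wedges_catN -catA lmulZr lmul_wedges_cat !size_map !size_mask ?size_iota //.
rewrite scalerA -exprD.
have E x1 x2 x3 : mask (a ++ [:: x1, x2, x3 & c]) (iota 0 (size (a ++ [:: x1, x2, x3 & c]))) =
  mask a (iota 0 p) ++ mask [:: x1; x2; x3] (iota p 3) ++ mask c (iota p.+3 (size c)).
  by have := mask_iota3 a [:: x1; x2; x3] c; rewrite sa.
case: x => /=; rewrite ?big_cons big_nil !E !map_cat /= ?addr0; last first.
  by rewrite [(count id c + _)%N]addnC.
rewrite /g ltnn eqxx wedges_swap addrC wedges_catD wedges_catNl.
rewrite opprD opprK.
rewrite [X in X - _]wedges_swap -opprD scalerN -scaleNr add1n addnS exprS mulN1r.
by rewrite addnC addrC.
Qed.

End MaskedWedges.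

(** * Splitting of masks, and concordance on words *)

Lemma split_cat p a (x : bool) c : size a = p ->
  (split_e p (a ++ x :: c) =
    if x then [:: a ++ [:: true, false, true & c]]
    else [:: a ++ [:: true, false, false & c]; a ++ [:: false, false, true & c]]) *
  (split_v p (a ++ x :: c) =
    if x then [:: a ++ [:: true, true, false & c]; a ++ [:: false, true, true & c]]
    else [:: a ++ [:: false, true, false & c]]).
Proof.
move=> sa; rewrite /split_e /split_v take_size_cat // nth_cat sa ltnn subnn /=.
by rewrite drop_cat sa ltnNge leqnSn /= subSnn /= drop0.
Qed.

Lemma cat_bits3 p a (b1 b2 b3 : bool) c : size a = p ->
  (take p (a ++ [:: b1, b2, b3 & c]) = a) *
  (nth false (a ++ [:: b1, b2, b3 & c]) p = b1) *
  (nth false (a ++ [:: b1, b2, b3 & c]) p.+2 = b3) *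
  (drop p.+3 (a ++ [:: b1, b2, b3 & c]) = c).
Proof.
move=> sa; rewrite take_size_cat // !nth_cat drop_cat sa ltnn subnn.
have -> : (p.+2 < p)%N = false by lia.
have -> : (p.+3 < p)%N = false by lia.
have -> : (p.+2 - p = 2)%N by lia.
have -> : (p.+3 - p = 3)%N by lia.
by rewrite /= drop0.
Qed.

(** [g] recovers the source of every element, so distinct sources give disjoint lists. *)
Lemma uniq_flatten_map (S T : eqType) (f : S -> seq T) (g : T -> S) (s : seq S) :
  uniq s -> {in s, forall x, uniq (f x)} ->
  {in s, forall x, {in f x, forall y, g y = x}} ->
  uniq (flatten (map f s)).
Proof.
elim: s => [//|x s IH] /= /andP[xs us] uf gf.
rewrite cat_uniq uf ?mem_head // IH ?andbT //=; first last.
- by move=> y ys; apply: gf; rewrite inE ys orbT.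
- by move=> y ys; apply: uf; rewrite inE ys orbT.
apply/hasPn => y /flatten_mapP[x' x's yx']; apply: contra xs => yx.
by rewrite -(gf x (mem_head _ _) y yx) (gf x' _ y yx') // inE x's orbT.
Qed.

(* l lists the blocks of the successive points of the circle. *)
Definition conc (l : seq nat) (b : bitseq) : bool :=
  all (fun x => count_mem x (mask (map negb b) l) == 1%N) l.

(* A singleton z between two points of the same block y can be removed together
   with one of these two points. *)
Inductive reducible : seq nat -> Prop :=
| reducible2 x y of x != y : reducible [:: x; y]
| reducible_insert s y t z of reducible (s ++ y :: t) & z \notin s ++ y :: t :
    reducible (s ++ [:: y, z, y & t]).

(** The singleton [z] must be omitted, so [b2] is false. The block [y] omits at most one of its two
    copies, so [b1] or [b3] holds, and it then omits as many points as after merging with bit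
    [b1 && b3]. *)
Lemma conc_insert s y t z a (b1 b2 b3 : bool) c :
  size a = size s -> size c = size t -> z \notin s ++ y :: t ->
  conc (s ++ [:: y, z, y & t]) (a ++ [:: b1, b2, b3 & c]) =
  [&& ~~ b2, b1 || b3 & conc (s ++ y :: t) (a ++ (b1 && b3) :: c)].
Proof.
move=> sa sc; rewrite mem_cat inE !negb_or => /and3P[zs zy zt].
have cnt0 (b : bitseq) (u : seq nat) : z \notin u -> count_mem z (mask b u) = 0%N.
  by move=> zu; apply/count_memPn; apply: contra zu; apply: mem_mask.
have cnt x (bb : bitseq) u : size bb = size u ->
    count_mem x (mask (map negb (a ++ bb ++ c)) (s ++ u ++ t)) =
    (count_mem x (mask (map negb a) s) + (count_mem x (mask (map negb bb) u)
     + count_mem x (mask (map negb c) t)))%N.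
  by move=> su; rewrite !map_cat !mask_cat ?size_map // !count_cat.
pose C1 x := count_mem x (mask (map negb (a ++ [:: b1, b2, b3 & c])) (s ++ [:: y, z, y & t])).
pose C2 x := count_mem x (mask (map negb (a ++ (b1 && b3) :: c)) (s ++ y :: t)).
have C1E := fun x => cnt x [:: b1; b2; b3] [:: y; z; y] erefl.
have C2E := fun x => cnt x [:: b1 && b3] [:: y] erefl.
rewrite -!/(C1 _) /= in C1E C2E.
have eC x : x != y -> x != z -> C1 x = C2 x.
  move=> xy xz; rewrite /C1 /C2 C1E C2E.
  by case: b1 {C1 C2 C1E C2E}; case: b2; case: b3; rewrite /= ?(eq_sym _ x) ?(negPf xy) ?(negPf xz).
have C1z : C1 z = ~~ b2.
  rewrite /C1 C1E !cnt0 //.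
  by case: b1 {C1 C2 C1E C2E eC}; case: b2; case: b3; rewrite /= ?eqxx ?(eq_sym y) ?(negPf zy).
have C1y : b1 || b3 -> C1 y = C2 y.
  rewrite /C1 /C2 C1E C2E.
  by case: b1 {C1 C2 C1E C2E eC C1z}; case: b2; case: b3; rewrite /= ?eqxx ?(negPf zy).
have C1y' : ~~ (b1 || b3) -> (1 < C1 y)%N.
  rewrite /C1 C1E.
  by case: b1 {C1 C2 C1E C2E eC C1z C1y}; case: b2; case: b3; rewrite /= ?eqxx ?(negPf zy); lia.
have memE x : x \in s ++ [:: y, z, y & t] = (x == z) || (x \in s ++ y :: t).
  by rewrite !mem_cat !inE; case: (x == y); case: (x == z); rewrite ?orbT.
apply/allP/and3P => [h|[nb2 b13 /allP h] x].
  have b13 : b1 || b3.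
    apply: contraT => /C1y'; have := h y; rewrite memE mem_cat mem_head !orbT.
    by move=> /(_ isT)/eqP; rewrite -/(C1 _) => ->.
  split=> //; first by have := h z; rewrite memE eqxx => /(_ isT)/eqP; rewrite -/(C1 _) C1z; case: (b2).
  apply/allP => x xl; have := h x; rewrite memE xl orbT => /(_ isT).
  rewrite -/(C1 _) -/(C2 _).
  have [->|xy] := eqVneq x y; first by rewrite C1y.
  rewrite eC //; apply: contraTneq xl => ->.
  by rewrite mem_cat inE !negb_or zs zy.
rewrite memE -/(C1 x); have [-> _|xz /= xl] := eqVneq x z; first by rewrite C1z nb2.
have := h x xl; rewrite -/(C2 x).
have [->|xy] := eqVneq x y; first by rewrite C1y.
by rewrite eC.
Qed.

(** * Expansion for reducible words *)

Section Expansion.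
Variables (R : realType) (m : nat).

(** [Le] lists the concordant masks and [Lv] the padded masks of the v_J. Both are fixed before [e],
    so the induction hypothesis applies to [collapse p e]; the constant bit count [k] gives all
    terms the same sign. *)
Lemma reducible_expansion l : reducible l -> exists k (Le Lv : seq bitseq),
  [/\ size l = k.+1.*2, uniq Le,
      forall b, (b \in Le) = (size b == size l) && conc l b
    & {in Le, forall b, count id b = k}] /\
  [/\ uniq Lv,
      {in Lv, forall b, [/\ size b = size l, nth false b 0 = false,
                           nth false b (size b).-1 = false & count id b = k]}
    & forall e : nat -> 'rV[R]_m,
        \sum_(b <- Le) masked_wedges e b = \sum_(b <- Lv) masked_wedges (vpair e) b].
Proof.
elim=> [x y xy|s y t z _ [k [Le [Lv [[sl uLe LeP Lek] [uLv LvP eqL]]]]] zl].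
  (* Both letters must be omitted: the only mask is empty, and both sides are the empty wedge. *)
  exists 0, [:: [:: false; false]], [:: [:: false; false]].
  split; split=> // b; rewrite ?big_seq1 //.
  - rewrite inE; case: b => [|b1 [|b2 [|b3 b]]]; rewrite ?eqseq_cons ?andbF //= /conc /=.
    rewrite !andbT; have yx : (y == x) = false by rewrite eq_sym (negPf xy).
    by case: b1; case: b2; rewrite /= ?eqxx ?yx ?(negPf xy).
  - by rewrite inE => /eqP->.
  - by rewrite inE => /eqP->.
pose p := size s.
have szP b : size b = size (s ++ y :: t) ->
    exists a (x : bool) c, [/\ b = a ++ x :: c, size a = p & size c = size t].
  move=> sb; have pb : (p < size b)%N by rewrite sb size_cat /= addnS ltnS leq_addr.
  exists (take p b), (nth false b p), (drop p.+1 b); split; first exact: split_nth.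
    by rewrite size_take pb.
  by rewrite size_drop sb size_cat /= addnS subSS addKn.
have Les b : b \in Le -> size b = size (s ++ y :: t) by rewrite LeP => /andP[/eqP].
have Lvs b : b \in Lv -> size b = size (s ++ y :: t) by case/LvP.
exists k.+1, (flatten (map (split_e p) Le)), (flatten (map (split_v p) Lv)).
split; split.
- by move: sl; rewrite !size_cat /=; lia.
(* Merging the outer bits by [&&] recovers the mask that was split; for [split_v] below, the merge
   is by [||]. *)
- apply: (uniq_flatten_map (g := fun b => take p b ++ (nth false b p && nth false b p.+2) :: drop p.+3 b)) => // b.
    move=> /Les/szP[a [x [c [-> sa sc]]]]; rewrite split_cat //.
    by case: x => //=; rewrite inE eqseq_cat // eqxx eqseq_cons.
  move=> /Les/szP[a [x [c [-> sa sc]]]] b'; rewrite split_cat //.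
  by case: x; rewrite !inE; [move/eqP->|case/orP=> /eqP->]; rewrite !(cat_bits3 _ _ _ _ sa).
- move=> b; apply/flatten_mapP/andP.
    case=> b' b'Le; have [a [x [c [eb' sa sc]]]] := szP _ (Les _ b'Le).
    move: b'Le; rewrite eb' split_cat // LeP => /andP[_ cb'].
    by case: x {eb'} cb' => cb'; rewrite !inE; [move/eqP->|case/orP=> /eqP->];
       rewrite conc_insert // cb' !size_cat /= sa sc.
  case=> /eqP sb; have : exists a b1 b2 b3 c, [/\ b = a ++ [:: b1, b2, b3 & c], size a = p & size c = size t].
    have pb : (p < size b)%N by move: sb; rewrite size_cat /= /p; lia.
    have pb1 : (p.+1 < size b)%N by move: sb; rewrite size_cat /= /p; lia.
    have pb2 : (p.+2 < size b)%N by move: sb; rewrite size_cat /= /p; lia.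
    exists (take p b), (nth false b p), (nth false b p.+1), (nth false b p.+2), (drop p.+3 b).
    rewrite -!drop_nth // cat_take_drop size_take pb size_drop sb size_cat /=; split=> //.
    by rewrite /p; lia.
  case=> a [b1 [b2 [b3 [c [-> sa sc]]]]]; rewrite conc_insert // => /and3P[nb2 b13 cb].
  exists (a ++ (b1 && b3) :: c).
    by rewrite LeP cb !size_cat /= sa sc eqxx.
  rewrite split_cat //; move: b13 nb2 {cb}.
  by case: b1; case: b2; case: b3 => //= _ _; rewrite !inE eqxx ?orbT.
- move=> b /flatten_mapP[b' b'Le].
  have [a [x [c [eb' sa sc]]]] := szP _ (Les _ b'Le).
  move: (Lek _ b'Le); rewrite eb' split_cat // count_cat /=.
  by case: x {eb'} => cb'; rewrite !inE; [move/eqP->|case/orP=> /eqP->];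
    rewrite count_cat /=; lia.
- apply: (uniq_flatten_map (g := fun b => take p b ++ (nth false b p || nth false b p.+2) :: drop p.+3 b)) => // b.
    move=> /Lvs/szP[a [x [c [-> sa sc]]]]; rewrite split_cat //.
    by case: x => //=; rewrite inE eqseq_cat // eqxx eqseq_cons.
  move=> /Lvs/szP[a [x [c [-> sa sc]]]] b'; rewrite split_cat //.
  by case: x; rewrite !inE; [case/orP=> /eqP->|move/eqP->]; rewrite !(cat_bits3 _ _ _ _ sa).
- move=> b /flatten_mapP[b' b'Lv].
  have [a [x [c [eb' sa sc]]]] := szP _ (Lvs _ b'Lv).
  move: (LvP _ b'Lv); rewrite eb' split_cat // count_cat.
  have E : size (a ++ x :: c) = (size a + size c).+1 by rewrite size_cat /= addnS.
  rewrite E /= !nth_cat => -[_ b0 bl ck].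
  (* An outer bit can be true only if bit p was. If p is the first or last position, that bit was
     false, so the end bits stay false. *)
  have {E} : forall b1 b2 b3, b = a ++ [:: b1, b2, b3 & c] -> (b1 ==> x) -> (b3 ==> x) ->
    (b1 + b2 + b3 = x.+1)%N ->
    [/\ size b = size (s ++ [:: y, z, y & t]), nth false b 0 = false,
        nth false b (size b).-1 = false & count id b = k.+1].
    move=> b1 b2 b3 -> b1x b3x e; split.
    - by rewrite !size_cat /= sa sc.
    - move: b0; rewrite nth_cat; case: ltnP => //.
      by rewrite leqn0 => /eqP->; rewrite /= => x0; move: b1x; rewrite x0; case: (b1).
    - move: bl; rewrite size_cat /= !addnS !nth_cat /=.
      have -> : ((size a + size c).+2 < size a)%N = false by lia.
      have -> : (size a + size c < size a)%N = false by lia.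
      have -> : ((size a + size c).+2 - size a = (size c).+2)%N by lia.
      rewrite addKn; case: (c) => [|c1 c'] //= x0.
      by move: b3x; rewrite x0; case: (b3).
    - rewrite count_cat /=; lia.
  by case: (x) => H; rewrite !inE; [case/orP=> /eqP e|move/eqP=> e]; exact: (H _ _ _ e).
- move=> e; pose M := e p + e p.+2.
  (* Up to this sign, both sides are the products by [M] of the two sums for [collapse p e], which
     are equal by induction. *)
  apply: (scalerI (a := (-1) ^+ k)); first by rewrite signr_eq0.
  have E1 : lmul M (\sum_(b <- Le) masked_wedges (collapse p e) b) =
      (-1) ^+ k *: \sum_(b <- flatten (map (split_e p) Le)) masked_wedges e b.
    rewrite lmul_sumr big_flatten big_map scaler_sumr big_seq [RHS]big_seq.
    apply: eq_bigr => b bLe; rewrite lmul_collapse_e ?Lek //.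
    by rewrite (Les _ bLe) size_cat /= addnS ltnS leq_addr.
  have E2 : lmul M (\sum_(b <- Lv) masked_wedges (vpair (collapse p e)) b) =
      (-1) ^+ k *: \sum_(b <- flatten (map (split_v p) Lv)) masked_wedges (vpair e) b.
    rewrite lmul_sumr big_flatten big_map scaler_sumr big_seq [RHS]big_seq.
    apply: eq_bigr => b bLv; rewrite lmul_collapse_v; first by case: (LvP _ bLv) => _ _ _ ->.
    by rewrite (Lvs _ bLv) size_cat /= addnS ltnS leq_addr.
  by rewrite -E1 -E2 eqL.
Qed.

End Expansion.

(** * Non-crossing labellings and their reducible words *)

Section Labellings.
Local Open Scope nat_scope.
Variable T : eqType.
Implicit Type lab : nat -> T.

(** Blocks are given by labels on natural numbers, so that deleting point x is composition with
    [bump x]. *)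
Definition nc_labelling n lab : Prop := forall a b c d,
  a < b -> b < c -> c < d -> d < n -> lab a = lab c -> lab b = lab d -> lab a = lab b.

(* The tilde points i and j are in the same dual block: no block meets both
   sides of the chord joining them. *)
Definition same_gap n lab i j : Prop := forall x y,
  x < n -> y < n -> lab x = lab y -> (x <= i < y) = (x <= j < y).

Definition same_block n lab i j : Prop :=
  odd i = odd j /\
  if odd i then same_gap n lab i./2 j./2 else lab i./2 = lab j./2.

Lemma same_block_sym n lab i j : same_block n lab i j -> same_block n lab j i.
Proof.
rewrite /same_block => -[-> h]; split=> //; case: odd h => // h x y xn yn e.
by rewrite h.
Qed.

Lemma same_block_trans n lab i j k :
  same_block n lab i j -> same_block n lab j k -> same_block n lab i k.
Proof.
rewrite /same_block => -[-> h] [e]; rewrite -e => h'; split=> //.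
case: odd h h' => [h h' x y xn yn exy|-> //].
by rewrite h // h'.
Qed.

Lemma same_block_refl n lab i : same_block n lab i i.
Proof. by split=> //; case: odd. Qed.

(** Letters are arbitrary names of blocks: only the equality pattern of [l] is prescribed. *)
Definition realizes N (l : seq nat) (S : nat -> nat -> Prop) : Prop :=
  [/\ reducible l, size l = N
    & forall i j, i < N -> j < N -> nth 0 l i = nth 0 l j <-> S i j].

(** Renumbering of the positions left once p + 1 and p + 2 are deleted. *)
Definition hop p i := if i <= p then i else i.+2.

(** [S] is determined by its restriction along [hop p], since p + 2 is equivalent to p and p + 1
    only to itself; a fresh letter and a copy of letter p complete the word. *)
Lemma realizes_insert N l (S : nat -> nat -> Prop) p :
  p < N -> (forall i, S i i) -> (forall i j, S i j -> S j i) ->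
  (forall i j k, S i j -> S j k -> S i k) ->
  S p p.+2 -> (forall i, i < N.+2 -> S i p.+1 -> i = p.+1) ->
  realizes N l (fun i j => S (hop p i) (hop p j)) ->
  exists l', realizes N.+2 l' S.
Proof.
move=> pN rS sS tS Sp S1 [rl sl lS].
pose z := (\max_(x <- l) x).+1.
have zl : z \notin l.
  apply/negP => /(leq_bigmax_seq (P := predT) (F := id)) /(_ isT).
  by rewrite /z ltnn.
have El : l = take p l ++ nth 0 l p :: drop p.+1 l.
  by rewrite -drop_nth ?sl // cat_take_drop.
have sp : size (take p l) = p by rewrite size_take sl pN.
exists (take p l ++ [:: nth 0 l p, z, nth 0 l p & drop p.+1 l]).
(* Left inverse of [hop p] that sends p + 2 to p; position p + 1 carries [z]. *)
pose g i := if i <= p then i else i - 2.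
have nthE i : nth 0 (take p l ++ [:: nth 0 l p, z, nth 0 l p & drop p.+1 l]) i =
    if i == p.+1 then z else nth 0 l (g i).
  rewrite nth_cat sp /g; case: (ltngtP i p) => ip.
  - by rewrite nth_take // ifN //; lia.
  - have [->|ip1] := eqVneq i p.+1; first by rewrite subSnn.
    have -> : i - p = (i - p - 2).+2 by lia.
    have [->|ip2] := eqVneq i p.+2.
      have -> : p.+2 - p - 2 = 0 by lia.
      by rewrite /= subn2.
    have -> : i - p - 2 = (i - p - 3).+1 by lia.
    by rewrite /= nth_drop; congr nth; lia.
  - by rewrite ip subnn ifN //; lia.
split.
- by apply: reducible_insert; rewrite -El.
- by rewrite !size_cat /= sp size_drop sl; lia.
have gN i : i < N.+2 -> i != p.+1 -> g i < N by move=> iN ip; rewrite /g; case: (leqP i p); lia.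
have Sg i : i != p.+1 -> S i (hop p (g i)).
  move=> ip; rewrite /g; case: leqP => h; first by rewrite /hop h.
  have [->|h2] := eqVneq i p.+2; first by rewrite subn2 /hop leqnn; apply: sS.
  by rewrite /hop ifN; [have -> : (i - 2).+2 = i by lia|lia].
have zg i : i < N.+2 -> i != p.+1 -> z <> nth 0 l (g i).
  by move=> iN ip e; move: zl; rewrite e mem_nth // sl gN.
move=> i j iN jN; rewrite !nthE.
have [->|ip] := eqVneq i p.+1; have [->|jp] := eqVneq j p.+1.
- by split.
- by split=> [/zg|/sS/S1] => [[]//|/(_ jN)/eqP]; rewrite (negPf jp).
- by split=> [/esym/zg|/S1] => [[]//|/(_ iN)/eqP]; rewrite (negPf ip).
rewrite lS ?gN //; split=> h.
  by apply: (tS _ _ _ (Sg i ip)); apply: (tS _ _ _ h); exact/sS/Sg.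
by apply: (tS _ _ _ _ (Sg j jp)); apply: (tS _ _ _ _ h); exact/sS/Sg.
Qed.

Lemma nc_bump n lab x : nc_labelling n.+1 lab -> nc_labelling n (lab \o bump x).
Proof.
by move=> nc a b c d ab bc cd dn /=; apply: nc; rewrite /bump; lia.
Qed.

(** The search starts at point 1: it is a singleton or has a partner to descend from. With x > 0,
    the position of the singleton has both neighbours inside the word. *)
Lemma adjacent_or_singleton n lab : 0 < n -> nc_labelling n.+1 lab ->
  (exists2 x, x < n & lab x = lab x.+1) \/
  (exists2 x, 0 < x <= n & forall y, y <= n -> lab y = lab x -> y = x).
Proof.
move=> n0 nc.
have single x : x <= n ->
    (forall y, y <= n -> lab y = lab x -> y = x) \/
    (exists2 y, y <= n & y <> x /\ lab y = lab x).
  move=> xn; case: (boolP [forall y : 'I_n.+1, (lab y == lab x) ==> (y == x :> nat)]).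
    move/forallP => h; left=> y yn e.
    by apply/eqP; apply: (implyP (h (Ordinal (yn : y < n.+1)))); apply/eqP.
  rewrite negb_forall => /existsP[y]; rewrite negb_imply => /andP[/eqP e /eqP ne].
  by right; exists y; rewrite // -ltnS.
(* Descent on the distance d: a partner of x + 1 strictly between x + 1 and x + d gives a closer
   pair, and one elsewhere puts x + 1 in the block of x, directly or by non-crossing. *)
have pair d x : 0 < d -> x + d <= n -> lab x = lab (x + d) ->
  (exists2 x, x < n & lab x = lab x.+1) \/
  (exists2 x, 0 < x <= n & forall y, y <= n -> lab y = lab x -> y = x).
  elim/ltn_ind: d x => d IH x d0 xd e.
  have [d1|d1] := eqVneq d 1; first by left; exists x; [lia|rewrite e d1 addn1].
  have [|s|[y yn [yx ey]]] := @single x.+1; first by lia.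
    by right; exists x.+1 => //; lia.
  case: (ltngtP y x.+1) => [yx1|yx1|//]; last first.
    case: (ltngtP y (x + d)) => [yd|yd|yd].
    - by apply: (IH (y - x.+1) _ x.+1); rewrite ?subnKC //; lia.
    - by left; exists x; [lia|apply: (nc x x.+1 (x + d) y) => //; lia].
    - by left; exists x; [lia|rewrite e -yd].
  case: (ltngtP y x) => [yd|yd|yd]; [|lia|].
    left; exists x; first lia.
    by rewrite -ey; symmetry; apply: (nc y x x.+1 (x + d)) => //; lia.
  by left; exists x; [lia|rewrite -{1}yd].
have [//|s|[y yn [yx ey]]] := @single 1; first by right; exists 1.
case: (ltngtP y 1) => [y1|y1|//].
  by apply: (pair (1 - y) y); rewrite ?subnKC //; lia.
by apply: (pair (y - 1) 1); rewrite ?subnKC //; lia.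
Qed.

(** Induction dropping one bar and one tilde point. If x and x + 1 share a block, tilde x is a
    singleton between them; if x is a singleton, the tilde points x - 1 and x on its two sides share
    a dual block. *)
Lemma nc_labelling_realizes n lab : nc_labelling n.+1 lab ->
  exists l, realizes n.+1.*2 l (same_block n.+1 lab).
Proof.
elim: n lab => [|n IH] lab nc.
  exists [:: 0; 1]; split=> //; first exact: reducible2.
  move=> [|[|i]] [|[|j]] //= _ _; split=> //;
    by [move=> _; exact: same_block_refl | case].
(* In both cases the index p + 1 is the singleton and the tilde indices are
   renumbered by [bump x]; the bar indices by [bump q]. *)
have step x q p : (q = x.+1 /\ p = x.*2) \/ (q = x /\ p.+1 = x.*2 /\ 0 < x) ->
    x <= n.+1 -> p < n.+1.*2 ->
    (forall i j, same_gap n.+1 (lab \o bump q) i j <->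
       same_gap n.+2 lab (bump x i) (bump x j)) ->
    same_block n.+2 lab p p.+2 ->
    (forall i, i < n.+2.*2 -> same_block n.+2 lab i p.+1 -> i = p.+1) ->
    exists l, realizes n.+2.*2 l (same_block n.+2 lab).
  move=> qp xn pn gapE Sp S1.
  have [l [rl sl lS]] := IH _ (nc_bump (x := q) nc).
  apply: (realizes_insert pn (same_block_refl n.+2 lab)
           (@same_block_sym n.+2 lab) (@same_block_trans n.+2 lab) Sp S1 (l := l)).
  split=> // i j iN jN; rewrite lS // /same_block.
  have oh k : odd (hop p k) = odd k by rewrite /hop; case: leqP => //= _; rewrite negbK.
  have hE k : (hop p k)./2 = if odd k then bump x k./2 else bump q k./2.
    by rewrite /hop /bump; case: leqP; case: ifP; lia.
  rewrite !oh !hE; case: (odd j) => /=; case: (odd i) => /=; split=> -[] // _ h; split=> //; exact/gapE.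
have [//|[x xn ex]|[x xn sx]] := adjacent_or_singleton _ nc.
  apply: (step x x.+1 x.*2).
  - by left.
  - by lia.
  - by lia.
  - move=> i j; split=> h a b an bn e.
      (* Inverse of [bump x.+1] that sends x + 1 to x, which has the same label. *)
      pose u a := if a <= x then a else a.-1.
      have lu c : lab (bump x.+1 (u c)) = lab c.
        rewrite /u /bump; case: (leqP c x) => cx; first by have -> : x.+1 <= c = false by lia.
        have [->|c1] := eqVneq c x.+1; first by rewrite /= ltnn ex.
        by have -> : (x < c.-1) + c.-1 = c by lia.
      have ule c k : (u c <= k) = (c <= bump x k) by rewrite /u /bump; case: (leqP c x); lia.
      have /= := h (u a) (u b); rewrite !lu !(ltnNge _ (u b)) !ule -!ltnNge; apply=> //;
        rewrite /u; case: ifP; lia.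
    have /= := h (bump x.+1 a) (bump x.+1 b).
    have ule c k : (bump x.+1 c <= bump x k) = (c <= k) by rewrite /bump; lia.
    by rewrite !(ltnNge _ (bump x.+1 b)) !ule -!ltnNge; apply=> //; rewrite /bump; lia.
  - by split; rewrite /= ?odd_double ?uphalf_double ?doubleK.
  (* The chord joining x and x + 1 isolates tilde x. *)
  - move=> i iN []; rewrite /= odd_double /= => oi; rewrite oi uphalf_double.
    move/(_ x x.+1 (ltnW xn) (xn : x.+1 < n.+2) ex); rewrite leqnn ltnSn /= => h.
    by move: oi h; lia.
apply: (step x x x.*2.-1).
- by right; split=> //; lia.
- by lia.
- by lia.
- move=> i j; split=> h a b an bn e.
    (* A pair through the singleton x is (x, x), whose interval is empty. *)
    have [ax|ax] := eqVneq a x.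
      by rewrite (sx b) -?e ?ax //; lia.
    have [bx|bx] := eqVneq b x.
      by rewrite (sx a) -?bx //; lia.
    pose u a := if a <= x then a else a.-1.
    have lu c : c != x -> bump x (u c) = c by rewrite /u /bump; case: (leqP c x); lia.
    have ule c k : c != x -> (u c <= k) = (c <= bump x k) by rewrite /u /bump; case: (leqP c x); lia.
    have /= := h (u a) (u b); rewrite !lu // !(ltnNge _ (u b)) !ule // -!ltnNge; apply=> //;
      rewrite /u; case: ifP; lia.
  have /= := h (bump x a) (bump x b).
  have ule c k : (bump x c <= bump x k) = (c <= k) by rewrite /bump; lia.
  by rewrite !(ltnNge _ (bump x b)) !ule -!ltnNge; apply=> //; rewrite /bump; lia.
(* Only a pair with end x could separate tilde x - 1 from tilde x. *)
- have -> : x.*2.-1.+2 = x.*2.+1 by lia.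
  split; first by lia.
  have -> : odd x.*2.-1 by lia.
  have -> : x.*2.-1./2 = x.-1 by lia.
  rewrite /= uphalf_double => a b an bn e.
  have [ax|ax] := eqVneq a x.
    by rewrite (sx b) -?e ?ax //; lia.
  have [bx|bx] := eqVneq b x.
    by rewrite (sx a) -?bx //; lia.
  by lia.
have -> : x.*2.-1.+1 = x.*2 by lia.
move=> i iN []; rewrite odd_double => oi; rewrite oi doubleK => /sx h.
by have := h _; lia.
Qed.

End Labellings.

(** * Subsets of ordinals as bit sequences *)

Definition bits N (I : {set 'I_N}) : bitseq := [seq i \in I | i <- enum 'I_N].

Lemma size_bits N (I : {set 'I_N}) : size (bits I) = N.
Proof. by rewrite size_map size_enum_ord. Qed.

Lemma nth_bits N (I : {set 'I_N}) (i : 'I_N) : nth false (bits I) i = (i \in I).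
Proof. by rewrite (nth_map i) ?size_enum_ord // nth_ord_enum. Qed.

Lemma bits_inj N : injective (@bits N).
Proof. by move=> I J e; apply/setP => i; rewrite -!nth_bits e. Qed.

Lemma bits_surj N (b : bitseq) : size b = N -> exists I : {set 'I_N}, bits I = b.
Proof.
move=> sb; exists [set i : 'I_N | nth false b i].
apply: (eq_from_nth (x0 := false)); rewrite size_bits ?sb // => i iN.
by rewrite (nth_bits _ (Ordinal iN)) inE.
Qed.

Lemma val_enum_bits N (I : {set 'I_N}) :
  map val (enum I) = mask (bits I) (iota 0 N).
Proof.
rewrite -val_enum_ord -map_mask -filter_mask; congr map.
by rewrite enumT; apply: eq_filter => i; rewrite inE.
Qed.

Lemma count_bits N (I : {set 'I_N}) : count id (bits I) = #|I|.
Proof.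
rewrite -(size_mask (s := iota 0 N)) ?size_iota ?size_bits //.
by rewrite -val_enum_bits size_map -cardE.
Qed.

(** * Linear independence of the v_J *)

Section Independence.
Variables (R : realType).

Lemma sum_set_sumn m (s : seq nat) (K : {set 'I_m}) :
  uniq s -> all (fun k => k < m)%N s -> (forall k, (k \in K) = (val k \in s)) ->
  (\sum_(i in K) i = sumn s)%N.
Proof.
move=> us /allP sm Ks; rewrite -big_enum -(big_map val predT id) -sumnE.
apply: perm_sumn; apply: uniq_perm => //.
  by rewrite (map_inj_uniq val_inj) enum_uniq.
move=> k; apply/mapP/idP => [[i]|ks]; first by rewrite mem_enum Ks => i_s ->.
by exists (Ordinal (sm k ks)); rewrite // mem_enum Ks.
Qed.

(** Choosing [stdb k.+2] in a factor raises the index sum by 2, so among sets of index sum at most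
    that of [s] only [s] itself occurs, with coefficient 1. *)
Lemma wedges_triangular m (s : seq nat) (K : {set 'I_m}) :
  sorted ltn s -> all (fun k => k < m)%N s -> (\sum_(i in K) i <= sumn s)%N ->
  wedges [seq (stdb k + stdb k.+2 : 'rV[R]_m) | k <- s] K =
  [forall k, (k \in K) == (val k \in s)]%:R.
Proof.
elim: s K => [|j s IH] K.
  move=> _ _ _; rewrite ffunE; congr (nat_of_bool _)%:R.
  apply/eqP/forallP => [-> k|h]; first by rewrite inE.
  by apply/setP => k; rewrite inE; apply/eqP/h.
move=> sjs /andP[jm sm] sK; rewrite map_cons wedges_cons lmulE.
have us := sorted_uniq ltn_trans ltnn (path_sorted sjs).
have js : all (ltn j) s by apply: order_path_min sjs; apply: ltn_trans.
have jns : j \notin s.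
  by apply/negP => /(allP js) /=; rewrite ltnn.
pose j' := Ordinal jm.
(* Such an i contributes only if it is j + 2; then K without i has a smaller index sum than [s], and
   its coordinate vanishes by induction. *)
have zero (i : 'I_m) : i \in K -> i != j' ->
   (-1) ^+ rank_in K i * ((stdb j + stdb j.+2) 0 i *
     wedges [seq (stdb k + stdb k.+2 : 'rV[R]_m) | k <- s] (K :\ i)) = 0.
  move=> iK ij; rewrite !mxE.
  have -> : (i == j :> nat) = false by apply/negP => /eqP e; case/eqP: ij; apply: val_inj.
  case: eqP => [e|_]; last by rewrite addr0 mul0r mulr0.
  have sKi : (\sum_(k in K :\ i) k + 2 <= sumn s)%N.
    by move: sK; rewrite (big_setD1 i iK) e; set S := (\sum_(k in _) _)%N; rewrite /=; lia.
  rewrite IH ?(path_sorted sjs) //; last by lia.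
  case: forallP => [h|_]; last by rewrite !mulr0.
  by move: sKi; rewrite (@sum_set_sumn _ s) // => [|k]; [lia|exact/eqP].
have [jK|jK] := boolP (j' \in K); last first.
  rewrite big1 => [|i iK]; last by apply: zero => //; apply: contraNneq jK => <-.
  rewrite (_ : [forall k, _] = false) //; apply/negP => /forallP/(_ j').
  by rewrite inE eqxx (negPf jK).
rewrite (bigD1 j') //= big1 => [|i /andP[iK ij]]; last exact: zero.
rewrite addr0 !mxE eqxx (_ : (j == j.+2) = false) ?addr0 ?mul1r; last by lia.
rewrite IH ?(path_sorted sjs) //; last first.
  by move: sK; rewrite (big_setD1 j' jK) /= leq_add2l.
have jj' (k : 'I_m) : (k == j') = (val k == j) by [].
case: forallP => [h|nh].
  have -> : rank_in K j' = 0%N.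
    apply/eqP; rewrite cards_eq0; apply/eqP/setP => k; rewrite !inE.
    apply/andP => -[kK kj]; have := h k; rewrite !inE kK jj' andbT.
    have -> /= : val k != j by rewrite neq_ltn kj.
    by rewrite eq_sym => /eqP/(allP js) /=; rewrite ltnNge ltnW.
  rewrite mulr1 expr0 (_ : [forall k, _]) //; apply/forallP => k.
  have := h k; rewrite !inE jj'; have [/val_inj -> _|//] := eqVneq (val k) (val j').
  by rewrite jK eqxx.
rewrite mulr0 (_ : [forall k, _] = false) //; apply/forallP => h; case: nh => k.
rewrite !inE jj'; have [->|kj] := eqVneq (val k) j; first by rewrite (negPf jns).
by have := h k; rewrite inE (negPf kj).
Qed.

Lemma v_wedgeE n (J : {set 'I_(n.*2 - 2)}) :
  v_wedge R J = wedges [seq stdb k + stdb k.+2 | k <- mask (bits J) (iota 0 (n.*2 - 2))].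
Proof. by rewrite -val_enum_bits -map_comp. Qed.

(** Among the J with non-zero coefficient one has least index sum; at the coordinate J all other
    terms vanish. *)
Lemma v_wedge_free n (P : pred {set 'I_(n.*2 - 2)}) (d : {set 'I_(n.*2 - 2)} -> R) :
  \sum_(J | P J) d J *: v_wedge R J = 0 -> forall J, P J -> d J = 0.
Proof.
move=> dep J0 PJ0; apply/eqP; apply: contraT => dJ0.
have PdJ0 : P J0 && (d J0 != 0) by rewrite PJ0.
case: (arg_minnP (P := fun J => P J && (d J != 0))
         (fun J : {set 'I_(n.*2 - 2)} => \sum_(i in J) i)%N PdJ0).
move=> J /andP[PJ dJ] minJ {J0 PJ0 dJ0 PdJ0}.
(* [J] as a subset of the larger index set of the e_k. *)
pose K := [set k : 'I_n.*2 | val k \in map val (enum J)].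
have sJ (I : {set 'I_(n.*2 - 2)}) : sorted ltn (map val (enum I)).
  by rewrite val_enum_bits; apply: sorted_mask (iota_ltn_sorted _ _); apply: ltn_trans.
have bJ (I : {set 'I_(n.*2 - 2)}) : all (fun k => k < n.*2)%N (map val (enum I)).
  by apply/allP => k /mapP[i _ ->]; apply: leq_trans (ltn_ord i) (leq_subr _ _).
have uJ (I : {set 'I_(n.*2 - 2)}) : uniq (map val (enum I)).
  exact: sorted_uniq ltn_trans ltnn _ (sJ I).
have sumJ (I : {set 'I_(n.*2 - 2)}) : (\sum_(i in I) i = sumn (map val (enum I)))%N.
  by rewrite sumnE big_map big_enum.
have sK : (\sum_(k in K) k = \sum_(i in J) i)%N.
  by rewrite sumJ; apply: sum_set_sumn => // k; rewrite inE.
have/ffunP/(_ K) := dep; rewrite sum_ffunE ffunE (bigD1 J) //= big1 => [|I /andP[PI IJ]].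
  rewrite ffunE v_wedgeE -val_enum_bits wedges_triangular ?sK ?sumJ //.
  rewrite (_ : [forall k, _]); last by apply/forallP => k; rewrite inE.
  by rewrite addr0 /GRing.scale /= mulr1 => /eqP; rewrite (negPf dJ).
rewrite ffunE; have [->|dI] := eqVneq (d I) 0; first by rewrite scale0r.
rewrite v_wedgeE -val_enum_bits wedges_triangular ?sK -?sumJ ?minJ ?PI //.
case: forallP => [h|_]; last by rewrite scaler0.
case/eqP: IJ; apply/setP => i.
have im : (i < n.*2)%N by apply: leq_trans (ltn_ord i) (leq_subr _ _).
have := h (Ordinal im); rewrite inE /= !(mem_map val_inj) !mem_enum.
by move/eqP.
Qed.

End Independence.

(** * Blocks of the partition and of its dual as letters of a word *)

Lemma bar_tilde_neq n (B C : {set 'I_n}) x : x \in B -> @bar n @: B <> @tilde n @: C.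
Proof.
move=> xB /setP/(_ (bar x)); rewrite imset_f // => /esym/imsetP[y _].
by move/(congr1 val) => /=; lia.
Qed.

Section Dual.
Local Open Scope nat_scope.
Variables (n : nat) (sigma : {set {set 'I_n.+1}}).
Hypotheses (psigma : partition sigma [set: 'I_n.+1]) (ncsigma : noncrossing sigma).

Definition block_of k : {set 'I_n.+1} := pblock sigma (inord k).

Lemma block_ofE (B : {set 'I_n.+1}) (i : 'I_n.+1) :
  B \in sigma -> (i \in B) = (block_of i == B).
Proof.
have /and3P[/eqP cs ts _] := psigma.
move=> Bs; rewrite /block_of inord_val; apply/idP/eqP => [|<-].
  exact: def_pblock.
by rewrite mem_pblock cs.
Qed.

Lemma block_of_mem k : block_of k \in sigma.
Proof. by apply: pblock_mem; have /and3P[/eqP-> _ _] := psigma. Qed.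

Lemma block_of_nc : nc_labelling n.+1 block_of.
Proof.
move=> a b c d ab bc cd dn eac ebd.
have cn := ltn_trans cd dn; have bn := ltn_trans bc cn; have an := ltn_trans ab bn.
move/noncrossingP: ncsigma => /(_ (block_of a) (block_of b) (Ordinal an) (Ordinal bn)
  (Ordinal cn) (Ordinal dn)); apply; rewrite ?block_ofE ?block_of_mem //=.
- by rewrite eac.
- by rewrite ebd.
Qed.

(** Turns the maximality defining the dual into a test on chords. A block of [sigma] separating two
    points of [C] would cross [C]; conversely, unseparated points can be joined, so the coarsest
    partition joins them. *)
Lemma dual_same_gap (C : {set 'I_n.+1}) (i j : 'I_n.+1) : C \in dual sigma -> i \in C ->
  j \in C <-> same_gap n.+1 block_of j i.
Proof.
have /and3P[pt /noncrossingP nct /forallP maxt] := dualP ncsigma => Ct iC.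
split.
  have sub (k k' : 'I_n.+1) x y : k \in C -> k' \in C -> x < n.+1 -> y < n.+1 ->
      block_of x = block_of y -> x <= k < y -> x <= k' < y.
    move=> kC k'C xn yn exy /andP[xk ky].
    have Bc : @bar n.+1 @: block_of x \in on_circle sigma (dual sigma).
      by apply/setUP; left; apply/imsetP; exists (block_of x); rewrite ?block_of_mem.
    have Cc : @tilde n.+1 @: C \in on_circle sigma (dual sigma).
      by apply/setUP; right; apply/imsetP; exists C.
    have xB : Ordinal xn \in block_of x by rewrite block_ofE ?block_of_mem.
    have yB : Ordinal yn \in block_of x by rewrite block_ofE ?block_of_mem // exy.
    apply/andP; split; rewrite leqNgt; apply/negP => h.
      apply: (@bar_tilde_neq _ (block_of x) C _ xB); apply/esym.
      apply: (nct _ _ (tilde k') (bar (Ordinal xn)) (tilde k) (bar (Ordinal yn)));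
        rewrite ?imset_f //=; move: h xk ky; clear; lia.
    apply: (@bar_tilde_neq _ (block_of x) C _ xB).
    apply: (nct _ _ (bar (Ordinal xn)) (tilde k) (bar (Ordinal yn)) (tilde k'));
      rewrite ?imset_f //=; move: h xk ky; clear; lia.
  by move=> jC x y xn yn exy; apply/idP/idP; apply: sub.
(* The partition whose only possibly non-trivial block is {i, j} is admissible,
   hence finer than the dual. *)
move=> gap; pose f (a : 'I_n.+1) := if a == j then i else a.
pose tau := preim_partition f [set: 'I_n.+1].
have ptau : partition tau [set: 'I_n.+1] by exact: preim_partitionP.
have /and3P[/eqP ctau ttau _] := ptau.
have tauE D a b : D \in tau -> a \in D -> (b \in D) = (f a == f b).
  move=> Dt aD.
  rewrite -(def_pblock ttau Dt aD) pblock_equivalence_partition ?inE //.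
  by split=> // /eqP->.
have pairE D (a b : 'I_n.+1) : D \in tau -> a \in D -> b \in D -> a < b ->
    (a = i /\ b = j) \/ (a = j /\ b = i).
  move=> Dt aD; rewrite (tauE D a) // /f => /eqP.
  case: (a =P j) => [->|_]; case: (b =P j) => [->|_]; rewrite ?ltnn //.
  - by move=> -> _; right.
  - by move=> -> _; left.
  - by move=> ->; rewrite ltnn.
have gapE D (a b : 'I_n.+1) x y : D \in tau -> a \in D -> b \in D -> a < b ->
    x < n.+1 -> y < n.+1 -> block_of x = block_of y -> (x <= a < y) = (x <= b < y).
  move=> Dt aD bD ab xn yn exy.
  by have [[-> ->]|[-> ->]] := pairE D a b Dt aD bD ab; rewrite (gap x y).
have nctau : noncrossing (on_circle sigma tau).
  apply/noncrossingP => B D a b c d.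
  case/setUP=> /imsetP[B' B't ->]; case/setUP=> /imsetP[D' D't ->];
  case/imsetP=> a' a'B ->; case/imsetP=> b' b'D ->;
  case/imsetP=> c' c'B ->; case/imsetP=> d' d'D -> /= ab bc cd.
  - have -> // : B' = D'.
    by move/noncrossingP: ncsigma => /(_ B' D' a' b' c' d'); apply => //; move: ab bc cd; clear; lia.
  - have := gapE D' b' d' a' c' D't b'D d'D.
    move: a'B c'B; rewrite !block_ofE // => /eqP-> /eqP-> h.
    by exfalso; have := h _ (ltn_ord a') (ltn_ord c') erefl; move: ab bc cd; clear; lia.
  - have := gapE B' a' c' b' d' B't a'B c'B.
    move: b'D d'D; rewrite !block_ofE // => /eqP-> /eqP-> h.
    by exfalso; have := h _ (ltn_ord b') (ltn_ord d') erefl; move: ab bc cd; clear; lia.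
  (* Both blocks would contain the same pair {i, j}, which cannot alternate with itself. *)
  - have := pairE D' b' d' D't b'D d'D; have := pairE B' a' c' B't a'B c'B.
    move=> h h'; exfalso.
    have [ac bd] : a' < c' /\ b' < d' by move: ab bc cd; clear; lia.
    case: (h ac) => -[e1 e2]; case: (h' bd) => -[e3 e4];
      move: ab bc cd; rewrite e1 e2 e3 e4; clear; lia.
have ref : refines tau (dual sigma) by apply: (implyP (maxt tau)); rewrite ptau nctau.
have jt : j \in cover tau by rewrite ctau inE.
have /exists_inP[C' C't sC'] := forall_inP ref _ (pblock_mem jt).
have jP : j \in pblock tau j by rewrite mem_pblock.
have iP : i \in pblock tau j.
  by rewrite (tauE _ j) ?pblock_mem // /f eqxx; case: (i == j).
have /and3P[_ tt _] := pt.
rewrite -(def_pblock tt Ct iC) (def_pblock tt C't (subsetP sC' _ iP)).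
exact: (subsetP sC').
Qed.

(** The positions with the letter of i form the block of i, and counting that letter under the
    negated mask counts the points of the block outside [I]. The size condition of [concordant] is
    derived later from the bit count. *)
Lemma concordant_conc l (I : {set 'I_n.+1.*2}) :
  realizes n.+1.*2 l (same_block n.+1 block_of) ->
  [forall B in sigma, #|(@bar n.+1 @: B) :\: I| == 1]
    && [forall B in dual sigma, #|(@tilde n.+1 @: B) :\: I| == 1] = conc l (bits I).
Proof.
case=> _ sl lS.
pose cls (i : 'I_n.+1.*2) := [set j : 'I_n.+1.*2 | nth 0 l j == nth 0 l i].
have cnt (i : 'I_n.+1.*2) : count_mem (nth 0 l i) (mask (map negb (bits I)) l) = #|cls i :\: I|.
  have El : l = [seq nth 0 l (val j) | j <- enum 'I_n.+1.*2].
    by rewrite (map_comp (nth 0 l)) val_enum_ord -sl map_nth_iota0 // take_size.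
  have -> : map negb (bits I) = [seq j \notin I | j <- enum 'I_n.+1.*2].
    by rewrite -map_comp.
  rewrite {2}El -map_mask -filter_mask count_map count_filter -sum1_count big_enum_cond sum1_card.
  by apply: eq_card => j; rewrite !inE andbC.
have barE B (i : 'I_n.+1) : B \in sigma -> i \in B -> @bar n.+1 @: B = cls (bar i).
  move=> Bs iB; apply/setP => j; rewrite inE; apply/imsetP/eqP.
    case=> k kB ->; apply/lS => //; split; rewrite /= !odd_double //= !doubleK.
    by move: iB kB; rewrite !block_ofE // => /eqP-> /eqP->.
  move/lS => /(_ (ltn_ord _) (ltn_ord _)) []; rewrite /= odd_double => oj; rewrite oj doubleK => e.
  have jn : j./2 < n.+1 by have := ltn_ord j; clear; lia.
  exists (Ordinal jn); last by apply: val_inj => /=; move: oj; clear; lia.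
  by move: iB; rewrite !block_ofE //= e.
have tildeE C (i : 'I_n.+1) : C \in dual sigma -> i \in C -> @tilde n.+1 @: C = cls (tilde i).
  move=> Cs iC; apply/setP => j; rewrite inE; apply/imsetP/eqP.
    case=> k kC ->; apply/lS => //; split; rewrite /= !odd_double //= !uphalf_double.
    exact/dual_same_gap/kC.
  move/lS => /(_ (ltn_ord _) (ltn_ord _)) []; rewrite /= odd_double => oj; rewrite oj /= uphalf_double => e.
  have jn : j./2 < n.+1 by have := ltn_ord j; clear; lia.
  exists (Ordinal jn); last by apply: val_inj => /=; move: oj; clear; lia.
  exact/(dual_same_gap _ Cs iC).
have /and3P[_ _ ns] := psigma.
have /and3P[/and3P[/eqP ct _ nt] _ _] := dualP ncsigma.
apply/andP/allP => [[/forall_inP hs /forall_inP ht] x|h].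
  case/(nthP 0) => i; rewrite sl => iN <-.
  have jn : i./2 < n.+1 by move: iN; clear; lia.
  rewrite (cnt (Ordinal iN)); case oi: (odd i).
    have -> : Ordinal iN = tilde (Ordinal jn) by apply: val_inj => /=; move: oi; clear; lia.
    have jc : Ordinal jn \in cover (dual sigma) by rewrite ct inE.
    by rewrite -(tildeE (pblock (dual sigma) (Ordinal jn))) ?pblock_mem ?mem_pblock // ht ?pblock_mem.
  have -> : Ordinal iN = bar (Ordinal jn) by apply: val_inj => /=; move: oi; clear; lia.
  by rewrite -(barE (block_of i./2)) ?block_ofE ?block_of_mem // hs ?block_of_mem.
split; apply/forall_inP => B Bs.
  have [i iB] : exists i, i \in B by apply/set0Pn; apply: contraNneq ns => <-.
  by rewrite (barE B i) // -cnt h // mem_nth ?sl.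
have [i iB] : exists i, i \in B by apply/set0Pn; apply: contraNneq nt => <-.
by rewrite (tildeE B i) // -cnt h // mem_nth ?sl.
Qed.

End Dual.

(** * Padded masks and reindexing of sums *)

Definition pad N (J : {set 'I_N}) : bitseq := false :: rcons (bits J) false.

Lemma pad_inj N : injective (@pad N).
Proof. by move=> I J [] /rcons_inj [] /bits_inj. Qed.

Lemma pad_surj N (b : bitseq) : size b = N.+2 -> nth false b 0 = false ->
  nth false b (size b).-1 = false -> exists J : {set 'I_N}, pad J = b.
Proof.
case: b => // x b; case/lastP: b => // b y; rewrite /= size_rcons /= => -[sb] ->.
rewrite nth_rcons ltnn eqxx => ->.
by have [J eJ] := bits_surj sb; exists J; rewrite /pad eJ.
Qed.

Lemma count_pad N (J : {set 'I_N}) : count id (pad J) = #|J|.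
Proof. by rewrite /pad /= -cats1 count_cat /= count_bits !addn0. Qed.

Lemma big_seq_preim (V : nmodType) (S : finType) (T : eqType) (f : S -> T) (s : seq T)
    (P : pred S) (F : T -> V) :
  injective f -> uniq s -> (forall x, P x = (f x \in s)) ->
  {in s, forall y, exists x, f x = y} ->
  \sum_(y <- s) F y = \sum_(x | P x) F (f x).
Proof.
move=> fI us PE fs; rewrite -[RHS]big_filter -(big_map f predT F).
apply: perm_big; apply: uniq_perm => //.
  by rewrite (map_inj_uniq fI) filter_uniq // index_enum_uniq.
move=> y; apply/idP/mapP => [ys|[x]].
  have [x fx] := fs y ys; exists x; last by rewrite fx.
  by rewrite mem_filter PE fx ys mem_index_enum.
by rewrite mem_filter PE => /andP[? _] ->.
Qed.

(** * The e_I and v_J as masked wedges, and membership in the exterior power of V *)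

Section Coordinates.
Variables (R : realType) (n : nat).

Lemma e_wedgeE m (I : {set 'I_m}) : e_wedge R I = masked_wedges stdb (bits I).
Proof.
by rewrite /e_wedge /masked_wedges size_bits -val_enum_bits -map_comp.
Qed.

Lemma masked_wedges_pad (J : {set 'I_(n.*2 - 2)}) :
  masked_wedges (vpair (@stdb R n.*2)) (pad J) = v_wedge R J.
Proof.
rewrite v_wedgeE /masked_wedges /pad; move: (bits J) (size_bits J).
move: (n.*2 - 2)%N => N b sb; rewrite [size _]/= size_rcons sb -cats1 -(addn1 N).
rewrite [iota _ _]/= [mask _ _]/= iotaD mask_cat ?sb ?size_iota // cats0.
by rewrite (iotaDl 1 0) -map_mask -map_comp.
Qed.

Lemma v_basis_Vspace (k : 'I_(n.*2 - 2)) : v_basis R k \in Vspace R n.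
Proof.
have kn := ltn_ord k.
have tel (q : nat) : (q <= 1)%N ->
    \sum_(i < n) (-1) ^+ i.+1 * ((i.*2 + q == k)%N%:R + (i.*2 + q == k.+2)%N%:R) = 0 :> R.
  (* Here q is 0 for the bar and 1 for the tilde coordinates. The sum telescopes along [G], which
     vanishes at both ends since q < k + 2 < 2n. *)
  move=> q1; pose G i : R := (-1) ^+ i * (i.*2 + q == k.+2)%N%:R.
  rewrite -(big_mkord predT (fun i => (-1) ^+ i.+1 * ((i.*2 + q == k)%N%:R + (i.*2 + q == k.+2)%N%:R))).
  rewrite (eq_bigr (fun i => G i.+1 - G i)) => [|i _].
    rewrite telescope_sumr // /G.
    have -> : (n.*2 + q == k.+2)%N = false by lia.
    have -> : (0.*2 + q == k.+2)%N = false by lia.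
    by rewrite !mulr0 subrr.
  rewrite /G mulrDr doubleS !addSn !eqSS; congr (_ + _).
  by rewrite exprS mulN1r mulNr.
rewrite inE; apply/andP; split; apply/eqP.
  rewrite -[RHS](tel 1%N) //; apply: eq_bigr => i _; rewrite !mxE /=.
  by rewrite addn1.
rewrite -[RHS](tel 0%N) //; apply: eq_bigr => i _; rewrite !mxE /=.
by rewrite addn0.
Qed.

Lemma expansion_in_ext_power (w : ext R n.*2) (c : {set 'I_(n.*2 - 2)} -> R) :
  is_expansion w c -> in_ext_power n.-1 (Vspace R n) w.
Proof.
move=> ->; pose A := [set J : {set 'I_(n.*2 - 2)} | #|J| == n.-1].
pose s (i : 'I_#|A|) := [seq v_basis R k | k <- enum (enum_val i)].
have ss i : size (s i) == n.-1.
  by rewrite size_map -cardE; have := enum_valP i; rewrite inE.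
exists #|A|, (fun i => c (enum_val i)), (fun i => Tuple (ss i)); split.
  by move=> i v /mapP[k _ ->]; apply: v_basis_Vspace.
rewrite (eq_bigl (fun J => J \in A)) => [|J]; last by rewrite inE.
by rewrite big_enum_val.
Qed.

End Coordinates.

(** * Expansion with coefficients 0 and 1, and its uniqueness *)

Lemma concordance_expansion (R : realType) n (sigma : {set {set 'I_n}}) :
  (0 < n)%N -> partition sigma [set: 'I_n] -> noncrossing sigma ->
  exists P : pred {set 'I_(n.*2 - 2)},
    is_expansion (concordance_vector R sigma) (fun J => (P J)%:R).
Proof.
case: n sigma => // n' sigma _ ps ncs; set m := (n'.+1.*2 - 2)%N.
have [l rl] := nc_labelling_realizes (block_of_nc ps ncs).
have [redl sl _] := rl.
have [k [Le [Lv [[sk uLe LeP Lek] [uLv LvP eqL]]]]] := reducible_expansion R n'.+1.*2 redl.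
have {sk} kE : k = n' by move: sk; rewrite sl; clear; lia.
(* The coefficient of v_J is 1 exactly when the padded mask of J, of length 2n, is listed in
   [Lv]. *)
subst k; exists (fun J => pad J \in Lv); rewrite /is_expansion.
have -> : concordance_vector R sigma = \sum_(b <- Le) masked_wedges stdb b.
  rewrite (big_seq_preim (f := @bits n'.+1.*2) (P := concordant sigma)) //.
  - by apply: eq_bigr => I _; rewrite e_wedgeE.
  - exact: bits_inj.
  - move=> I; rewrite LeP size_bits sl eqxx /= -(concordant_conc ps ncs I rl).
    (* The size of I comes from the bit count of the masks in [Le]. *)
    rewrite /concordant; apply: andb_idl => h; rewrite -count_bits Lek //.
    by rewrite LeP size_bits sl eqxx -(concordant_conc ps ncs I rl).
  - by move=> b; rewrite LeP sl => /andP[/eqP sb _]; apply: bits_surj.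
rewrite eqL (big_seq_preim (f := @pad m) (P := fun J => pad J \in Lv)) //; first last.
- move=> b /LvP[]; rewrite sl => sb b0 bl _; apply: pad_surj => //.
  by rewrite sb /m; clear; lia.
- exact: pad_inj.
rewrite [RHS](bigID (fun J => pad J \in Lv)) /= [X in _ + X]big1 ?addr0 => [|J /andP[_ /negPf->]].
  apply: eq_big => [J|J JL]; last by rewrite JL scale1r masked_wedges_pad.
  rewrite andb_idl // => /LvP[_ _ _]; rewrite count_pad => ->.
  exact: eqxx.
by rewrite scale0r.
Qed.

Theorem theorem4p16 (R : realType) (n : nat) (sigma : {set {set 'I_n}}) :
  (0 < n)%N ->
  partition sigma [set: 'I_n] ->
  noncrossing sigma ->
  [/\ in_ext_power n.-1 (Vspace R n) (concordance_vector R sigma),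
      exists c : {set 'I_(n.*2 - 2)} -> R,
        is_expansion (concordance_vector R sigma) c
    & forall c : {set 'I_(n.*2 - 2)} -> R,
        is_expansion (concordance_vector R sigma) c ->
        forall J : {set 'I_(n.*2 - 2)}, #|J| = n.-1 -> c J = 0 \/ c J = 1].
Proof.
move=> n0 ps ncs; have [P expP] := concordance_expansion R n0 ps ncs.
split.
- exact: expansion_in_ext_power expP.
- by exists (fun J => (P J)%:R).
move=> c expc J /eqP cJ.
(* Two expansions of one vector differ by a vanishing combination, so freeness identifies [c J] with
   the indicator of [P]. *)
have : \sum_(I : {set 'I_(n.*2 - 2)} | #|I| == n.-1) (c I - (P I)%:R) *: v_wedge R I = 0.
  under eq_bigr do rewrite scalerBl.
  by rewrite sumrB -expc -expP subrr.
move/v_wedge_free/(_ J cJ)/eqP; rewrite subr_eq0 => /eqP->.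
by case: (P J); [right|left].
Qed.
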